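(* Let $1\le p<\infty$ and let $w=\{w_n\}_{n\in\mathbb{N}}$ be a bounded sequence of positive real numbers. Let $B_w:\ell^p(\mathbb{N})\to\ell^p(\mathbb{N})$ be the unilateral weighted backward shift with weights $w$. Then $$\{0\}\cup\{\lambda\in\mathbb{C}:|\lambda|<\tilde{r}\}\subseteq\sigma_p(B_w)\subseteq\{\lambda\in\mathbb{C}:|\lambda|\le\tilde{r}\},$$ where $\tilde{r}=\liminf_{n\to\infty}\left(w_2\cdots w_{n+1}\right)^{1/n}$.
   Context: $\mathbb{N}$ is the set of positive integers, and $\ell^p(\mathbb{N})$ is the complex Banach space of $p$-summable sequences. The unilateral weighted backward shift is $B_w(\{x_1,x_2,\dots\})=\{w_2x_2,w_3x_3,\dots\}$. The point spectrum $\sigma_p(T)$ of a bounded operator $T$ is the set of all $\lambda\in\mathbb{C}$ such that $T-\lambda I$ is not injective, i.e. the set of eigenvalues of $T$. *)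

(* Defs.v *)
(* MathComp / MathComp-Analysis *)
From HB Require Import structures.
From mathcomp Require Import all_boot all_order all_algebra.
From mathcomp Require Import all_classical all_reals all_analysis.
From mathcomp Require Import complex.

Set Implicit Arguments.
Unset Strict Implicit.
Unset Printing Implicit Defensive.

Import Order.TTheory GRing.Theory Num.Theory.
Import numFieldNormedType.Exports.
Import ComplexField.

Local Open Scope classical_set_scope.
Local Open Scope ring_scope.
Local Open Scope complex_scope.

(* Sequences indexed by the positive integers are functions on [nat] with the
   index shifted by one: [x n] stands for x_{n+1}. *)

(* [Normc.normc z : R] is the modulus of [z : R[i]]; the generic norm [`|z|]
   is the same number, but has type [R[i]]. The argument [1 <= p] is unused in
   the condition; it makes [lp_pred] canonically a submodule. *)
Definition lp_pred (R : realType) (p : R) of 1 <= p : {pred nat -> R[i]} :=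
  mem [set x : nat -> R[i] |
    (\sum_(0 <= n <oo) ((Normc.normc (x n)) `^ p)%:E < +oo)%E].

Record lp_space (R : realType) (p : R) (p1 : 1 <= p) :=
  LpSpace { lp_val :> nat -> R[i] ; _ : lp_val \in lp_pred p1 }.

Section lp_space_lmodule.
Context {R : realType} (p : R) (p1 : 1 <= p).

HB.instance Definition _ := [isSub for @lp_val R p p1].
HB.instance Definition _ := [Choice of lp_space p1 by <:].

Lemma lp_predP (x : nat -> R[i]) : x \in lp_pred p1 <->
  (\sum_(0 <= n <oo) ((Normc.normc (x n)) `^ p)%:E < +oo)%E.
Proof. by split; rewrite inE. Qed.

Lemma lp_gt0 : 0 < p.
Proof. by rewrite (lt_le_trans _ p1). Qed.

Lemma normc_ge0 (z : R[i]) : 0 <= Normc.normc z.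
Proof. by case: z => a b; exact: sqrtr_ge0. Qed.

Lemma lp_pred_le (M : R) (x y : nat -> R[i]) : 0 <= M ->
  (forall n, Normc.normc (y n) `^ p <= M * Normc.normc (x n) `^ p) ->
  x \in lp_pred p1 -> y \in lp_pred p1.
Proof.
move=> M0 yx /lp_predP xp; apply/lp_predP.
apply: (@le_lt_trans _ _
  (\sum_(0 <= n <oo) (M%:E * (Normc.normc (x n) `^ p)%:E))%E).
  apply: lee_nneseries => n *; first by rewrite lee_fin powR_ge0.
  by rewrite -EFinM lee_fin.
rewrite nneseriesZl; last by move=> *; rewrite lee_fin powR_ge0.
by rewrite lte_mul_pinfty// lee_fin.
Qed.

Lemma lp_pred_submod_closed : submod_closed (lp_pred p1).
Proof.
split.
  apply/lp_predP; rewrite eseries0 // => n _ _ /=.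
  by rewrite expr0n addr0 sqrtr0 powR0// gt_eqF// lp_gt0.
move=> a x y xp yp; apply/lp_predP.
have axp : a *: x \in lp_pred p1.
  apply: (lp_pred_le (M := Normc.normc a `^ p)) xp; first exact: powR_ge0.
  by move=> n; rewrite -powRM ?normc_ge0// -Normc.normcM.
move: axp; set z := a *: x => zp.
apply: (@le_lt_trans _ _ (\sum_(0 <= n <oo)
   ((2 `^ p)%:E * (Normc.normc (z n) `^ p)%:E +
    (2 `^ p)%:E * (Normc.normc (y n) `^ p)%:E))%E).
  apply: lee_nneseries => n *; first by rewrite lee_fin powR_ge0.
  rewrite -!EFinM -EFinD lee_fin -!powRM ?normc_ge0//.
  have := normc_ge0 (z n); have := normc_ge0 (y n).
  have -> : (z + y) n = z n + y n by [].
  have := le_normcD (z n) (y n).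
  have := normc_ge0 (z n + y n).
  move: (Normc.normc _) (Normc.normc (z n)) (Normc.normc (y n)) => c u v.
  move=> c0 cuv v0 u0; have p0 := ltW lp_gt0; have [uv|vu] := leP u v.
  - apply: (@le_trans _ _ ((2 * v) `^ p)); last by rewrite lerDr powR_ge0.
    apply: ge0_ler_powR; rewrite ?nnegrE ?mulr_ge0//.
    by rewrite mulr_natl mulr2n (le_trans cuv)// lerD2r.
  - apply: (@le_trans _ _ ((2 * u) `^ p)); last by rewrite lerDl powR_ge0.
    apply: ge0_ler_powR; rewrite ?nnegrE ?mulr_ge0//.
    by rewrite mulr_natl mulr2n (le_trans cuv)// lerD2l ltW.
rewrite nneseriesD; try by move=> *; rewrite -EFinM lee_fin mulr_ge0 ?powR_ge0.
rewrite !nneseriesZl; try by move=> *; rewrite lee_fin powR_ge0.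
move/lp_predP: zp => zp; move/lp_predP: yp => yp.
by rewrite lte_add_pinfty// lte_mul_pinfty// ?lee_fin ?powR_ge0.
Qed.

HB.instance Definition _ :=
  GRing.isSubmodClosed.Build _ _ (lp_pred p1) lp_pred_submod_closed.
HB.instance Definition _ := [SubChoice_isSubLmodule of lp_space p1 by <:].

End lp_space_lmodule.

Section backward_shift.
Context {R : realType} (p : R) (p1 : 1 <= p).
Context (w : nat -> R) (wb : bounded_fun w).

Lemma lp_pred_shift (x : lp_space p1) :
  (fun n => (w n.+1)%:C * x n.+1) \in lp_pred p1.
Proof.
have [M M0 wM] : exists2 M : R, 0 <= M & forall n, `|w n| <= M.
  case/pinfty_ex_gt0 : wb => M M0 wM; exists M; first exact: ltW.
  by move=> n; exact: wM.
apply: (lp_pred_le (x := fun n => x n.+1) (M := M `^ p)).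
- exact: powR_ge0.
- move=> n; rewrite -powRM ?normc_ge0//.
  apply: ge0_ler_powR; rewrite ?nnegrE ?mulr_ge0 ?normc_ge0 ?(ltW (lp_gt0 p1))//.
  rewrite Normc.normcM ler_wpM2r ?normc_ge0//=.
  by rewrite expr0n addr0 sqrtr_sqr wM.
- have /lp_predP xp := valP x; apply/lp_predP; apply: le_lt_trans xp.
  rewrite [leRHS]nneseries_recl//; last first.
    by move=> *; rewrite lee_fin powR_ge0.
  rewrite -(nneseries_addn 1%N); last by move=> *; rewrite lee_fin powR_ge0.
  rewrite (eq_eseriesr (g := fun n => (Normc.normc (x (n + 1)%N) `^ p)%:E)).
    by rewrite leeDr// lee_fin powR_ge0.
  by move=> n _; rewrite addn1.
Qed.

Definition backward_shift (x : lp_space p1) : lp_space p1 :=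
  LpSpace (lp_pred_shift x).

Lemma backward_shift_is_linear : linear backward_shift.
Proof.
move=> a x y; apply/val_inj/funext => n /=.
rewrite -[LHS]/((w n.+1)%:C * (a * x n.+1 + y n.+1)).
rewrite -[RHS]/(a * ((w n.+1)%:C * x n.+1) + (w n.+1)%:C * y n.+1).
by rewrite mulrDr mulrCA.
Qed.

HB.instance Definition _ := GRing.isLinear.Build R[i] (lp_space p1)
  (lp_space p1) _ backward_shift backward_shift_is_linear.

End backward_shift.

Arguments backward_shift {R p} p1 {w} wb x.

Definition point_spectrum (K : fieldType) (V : lmodType K)
    (T : {linear V -> V}) : set K :=
  [set lambda | ~ injective (fun x : V => T x - lambda *: x)].

(* [w k] stands for w_{k+1}, so the product is w_2 ... w_{n+1}; the term at
   n = 0 does not affect the limit inferior. *)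
Definition shift_radius (R : realType) (w : nat -> R) : R :=
  limn_inf (fun n => (\prod_(1 <= k < n.+1) w k) `^ (n%:R^-1)).

(* Main.v *)
Require Import Defs.
From mathcomp Require Import all_boot all_order all_algebra.
From mathcomp Require Import all_classical all_reals all_analysis.
From mathcomp Require Import complex.

(** The eigenvalue equation for the backward shift is the recursion
    w_(n+2) x_(n+2) = lambda x_(n+1), so an eigenvector for lambda is determined
    by its first coordinate: up to a scalar it is the sequence lambda^n / P_n,
    n >= 0, where P_n = w_2 ... w_(n+1). Hence lambda is an eigenvalue exactly
    when this sequence belongs to l^p ([point_spectrum_shiftP]), and it remains
    to compare |lambda|^n with P_n.

    If |lambda| < c < liminf P_n^(1/n), then c^n <= P_n for all large n, so the
    sequence is dominated by a multiple of the geometric sequence (|lambda|/c)^n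
    and is p-summable ([lp_pred_geometric]). For lambda = 0 the sequence is
    (1, 0, 0, ...), whatever the limit inferior is.

    Conversely, the terms of a p-summable sequence tend to 0
    ([lp_space_near_le]); in particular they eventually have modulus at most 1,
    that is, |lambda|^n <= P_n. So |lambda| is an eventual lower bound of
    P_n^(1/n), hence at most its limit inferior.

    The limit inferior is the real-valued one, which is a meaningful limit only
    for bounded sequences; this is where boundedness of the weights enters
    ([bounded_weight_root]). *)

Import Order.TTheory GRing.Theory Num.Theory.
Import numFieldNormedType.Exports.
Import ComplexField.

Local Open Scope classical_set_scope.
Local Open Scope ring_scope.

Lemma near_le_of_lt_limn_inf (R : realType) (u : R ^nat) (c : R) :
  bounded_fun u -> c < limn_inf u -> \forall n \near \oo, c <= u n.
Proof.
move=> ub; rewrite limn_infE// => /sup_gt; case.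
  by exists (infs u 0), 0%N.
move=> _ [N _ <-] cN; exists N => // n /= Nn.
apply: (le_trans (ltW cN)); apply: ge_inf; last by exists n.
exact/has_lbound_sdrop/bounded_fun_has_lbound.
Qed.

Lemma limn_inf_ge_of_near (R : realType) (u : R ^nat) (c : R) :
  bounded_fun u -> (\forall n \near \oo, c <= u n) -> c <= limn_inf u.
Proof.
move=> ub [N _ cu]; rewrite limn_infE//.
apply: (@le_trans _ _ (infs u N)).
  apply: lb_le_inf; first by exists (u N), N => /=.
  by move=> _ [n /= Nn <-]; exact: cu.
apply: ub_le_sup; last by exists N.
exact: bounded_fun_has_ubound_infs.
Qed.

Lemma powR_invK (R : realType) (y : R) (n : nat) :
  0 <= y -> (0 < n)%N -> (y `^ n%:R^-1) ^+ n = y.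
Proof.
move=> y0 n0.
by rewrite -powR_mulrn ?powR_ge0// -powRrM mulVf ?powRr1// pnatr_eq0 -lt0n.
Qed.

Lemma le_powR_inv (R : realType) (c y : R) (n : nat) :
  0 <= c -> 0 <= y -> (0 < n)%N -> (c <= y `^ n%:R^-1) = (c ^+ n <= y).
Proof.
move=> c0 y0 n0; rewrite -[in RHS](powR_invK _ _ _ y0 n0).
by rewrite ler_pXn2r// nnegrE powR_ge0.
Qed.

Lemma ubound_of_near_le (R : realType) (f : R ^nat) (M : R) :
  (\forall n \near \oo, f n <= M) -> exists2 K, 0 <= K & forall n, f n <= K.
Proof.
move=> [N _ fM]; exists (`|M| + \sum_(k < N) `|f k|).
  by rewrite addr_ge0// sumr_ge0.
move=> n; have [nN|Nn] := ltnP n N.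
  rewrite (bigD1 (Ordinal nN))//= addrCA (le_trans (ler_norm _))// lerDl.
  by rewrite addr_ge0// sumr_ge0.
by rewrite (le_trans (fM _ Nn))// (le_trans (ler_norm M))// lerDl sumr_ge0.
Qed.

(** The p-th powers of a geometric sequence of ratio q form a geometric sequence
    of ratio q^p < 1. *)
Lemma lp_pred_geometric (R : realType) (p : R) (p1 : 1 <= p)
    (x : nat -> R[i]) (K q : R) : 0 <= K -> 0 <= q < 1 ->
  (forall n, Normc.normc (x n) <= K * q ^+ n) -> x \in lp_pred p1.
Proof.
move=> K0 /andP[q0 q1] xK; have p0 := lp_gt0 p1; apply/lp_predP.
have qp1 : `|q `^ p| < 1.
  rewrite ger0_norm ?powR_ge0// -[ltRHS](congr1 (@^~ p) (powR1 R)).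
  by rewrite gt0_ltr_powR ?nnegrE// ltW.
apply: (@le_lt_trans _ _
    (\sum_(0 <= n <oo) (geometric (K `^ p) (q `^ p) n)%:E)%E).
  apply: lee_nneseries => n *; first by rewrite lee_fin powR_ge0.
  rewrite lee_fin /= -[(q `^ p) ^+ n]powR_mulrn ?powR_ge0//.
  rewrite -powRrM mulrC [p * _]mulrC powRrM powR_mulrn// mulrC.
  rewrite -powRM ?exprn_ge0//.
  by apply: ge0_ler_powR; rewrite ?nnegrE ?normc_ge0 ?mulr_ge0 ?exprn_ge0// ltW.
have -> : (fun n => \sum_(0 <= k < n) (geometric (K `^ p) (q `^ p) k)%:E)%E
    = EFin \o series (geometric (K `^ p) (q `^ p)).
  by apply/funext => n; rewrite /= /series/= sumEFin.
by rewrite EFin_lim ?ltry//; exact: is_cvg_geometric_series.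
Qed.

(** The p-th powers of the moduli are the terms of a convergent series, so they
    tend to 0, and taking p-th powers reflects the order. *)
Lemma lp_space_near_le (R : realType) (p : R) (p1 : 1 <= p)
    (x : lp_space p1) (e : R) :
  0 < e -> \forall n \near \oo, Normc.normc (x n) <= e.
Proof.
move=> e0; have p0 := lp_gt0 p1.
have /lp_predP/nnseries_is_cvg := valP x.
move=> /(_ (fun=> powR_ge0 _ _))/cvg_series_cvg_0.
move=> /cvgr0Pnorm_le /(_ _ (powR_gt0 p e0)).
apply: filterS => n; rewrite ger0_norm ?powR_ge0// => xe.
rewrite leNgt; apply/negP => ex; move: xe; rewrite leNgt => /negP; apply.
by rewrite gt0_ltr_powR ?nnegrE ?normc_ge0// ltW.
Qed.

(** By linearity, two points with the same image under T - lambda differ by a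
    vector of its kernel. *)
Lemma point_spectrumP (K : fieldType) (V : lmodType K)
    (T : {linear V -> V}) (lambda : K) :
  point_spectrum T lambda <-> exists2 x : V, x != 0 & T x = lambda *: x.
Proof.
split=> [ninj|[x x0 Tx] inj].
  apply: contrapT => noeig; apply: ninj => x y xy.
  apply/eqP; rewrite -subr_eq0; apply: contrapT => /negP xy0.
  apply: noeig; exists (x - y) => //.
  move: xy => /= /(canRL (subrK _)) Tx; rewrite linearB scalerBr Tx.
  by rewrite addrAC [T y - _ - _]addrAC subrr add0r addrC.
by move/eqP: x0; apply; apply: inj; rewrite Tx linear0 scaler0 !subrr.
Qed.

Section eigenvectors.
Context {R : realType} (w : nat -> R) (w_gt0 : forall n, 0 < w n).

Definition weight_prod (n : nat) : R := \prod_(1 <= k < n.+1) w k.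

Lemma weight_prod0 : weight_prod 0 = 1.
Proof. by rewrite /weight_prod big_geq. Qed.

Lemma weight_prodS n : weight_prod n.+1 = weight_prod n * w n.+1.
Proof. by rewrite /weight_prod big_nat_recr. Qed.

Lemma weight_prod_gt0 n : 0 < weight_prod n.
Proof. by rewrite /weight_prod prodr_gt0. Qed.

(** If M bounds the weights then P_n <= M^n, so the n-th root is at most M for
    n > 0. *)
Lemma bounded_weight_root :
  bounded_fun w -> bounded_fun (fun n => weight_prod n `^ n%:R^-1).
Proof.
move=> /pinfty_ex_gt0[M M0 wM].
(* The summand 1 accounts for the value at n = 0, which is 1 even if M < 1. *)
exists (1 + M); split; first exact: num_real.
move=> C /ltW MC n _ /=; rewrite ger0_norm ?powR_ge0//; apply: le_trans MC.
case: n => [|n]; first by rewrite weight_prod0 powR1 lerDl ltW.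
have PM : weight_prod n.+1 <= M ^+ n.+1.
  elim: n.+1 => [|m IHm]; first by rewrite weight_prod0 expr0.
  rewrite weight_prodS exprSr.
  rewrite ler_pM// ?(ltW (w_gt0 _)) ?(ltW (weight_prod_gt0 _))//.
  by rewrite (le_trans (ler_norm _))// wM.
rewrite (@le_trans _ _ M)// ?lerDr//.
rewrite -(ler_pXn2r (ltn0Sn n)) ?nnegrE ?powR_ge0 ?(ltW M0)//.
by rewrite powR_invK// ltW ?weight_prod_gt0.
Qed.

Definition eigenseq (lambda : R[i]) (n : nat) : R[i] :=
  lambda ^+ n / (weight_prod n)%:C%C.

Lemma normc_real (r : R) : 0 <= r -> Normc.normc r%:C%C = r.
Proof. by move=> r0; rewrite /= expr0n addr0 sqrtr_sqr ger0_norm. Qed.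

Lemma normcX (z : R[i]) n : Normc.normc (z ^+ n) = Normc.normc z ^+ n.
Proof.
by elim: n => [|n IHn]; rewrite ?Normc.normc1// !exprS Normc.normcM IHn.
Qed.

Lemma normc_eigenseq lambda n :
  Normc.normc (eigenseq lambda n) = Normc.normc lambda ^+ n / weight_prod n.
Proof.
rewrite /eigenseq Normc.normcM Normc.normcV normcX normc_real//.
exact/ltW/weight_prod_gt0.
Qed.

Lemma weightC_neq0 n : (w n)%:C%C != 0 :> R[i].
Proof. by rewrite eq_complex /= gt_eqF. Qed.

Lemma shift_eigenseq lambda n :
  (w n.+1)%:C%C * eigenseq lambda n.+1 = lambda * eigenseq lambda n.
Proof.
rewrite /eigenseq weight_prodS rmorphM exprS invfM mulrC !mulrA.
by rewrite divfK// weightC_neq0.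
Qed.

(** The weights being nonzero, the recursion can be solved for the next
    coordinate. *)
Lemma shift_eigenvectorE lambda (x : nat -> R[i]) :
  (forall n, (w n.+1)%:C%C * x n.+1 = lambda * x n) ->
  forall n, x n = eigenseq lambda n * x 0.
Proof.
move=> xS; elim=> [|n IHn].
  by rewrite /eigenseq weight_prod0 expr0 divr1 mul1r.
apply: (mulfI (weightC_neq0 n.+1)); rewrite xS IHn [RHS]mulrA.
by rewrite shift_eigenseq mulrA.
Qed.

End eigenvectors.

(** All eigenspaces are at most one-dimensional, so only one candidate
    eigenvector has to be tested for p-summability. *)
Lemma point_spectrum_shiftP (R : realType) (p : R) (p1 : 1 <= p)
    (w : nat -> R) (w_gt0 : forall n, 0 < w n) (wb : bounded_fun w)
    (lambda : R[i]) :
  point_spectrum (backward_shift p1 wb) lambda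
  <-> eigenseq w lambda \in lp_pred p1.
Proof.
split=> [/point_spectrumP[x x0 Tx]|xp].
  have xE : forall n, x n = eigenseq w lambda n * x 0.
    apply: shift_eigenvectorE => // n.
    by have /(congr1 (fun y : lp_space p1 => y n)) := Tx.
  have x00 : x 0%N != 0.
    apply: contra_neq x0 => x00; apply/val_inj/funext => n /=.
    by rewrite xE x00 mulr0.
  have -> : eigenseq w lambda = val ((x 0)^-1 *: x).
    apply/funext => n; rewrite -[RHS]/((x 0)^-1 * x n) (xE n).
    by rewrite mulrCA mulVf// mulr1.
  exact: valP.
apply/point_spectrumP; exists (LpSpace xp).
  apply/eqP => /(congr1 (fun y : lp_space p1 => y 0%N)) /=.
  rewrite /eigenseq weight_prod0 expr0 divr1 => /eqP.
  by apply/negP; exact: oner_neq0.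
by apply/val_inj/funext => n; exact: shift_eigenseq.
Qed.

Theorem proposition3p1p4 (R : realType) (p : R) (p1 : 1 <= p)
    (w : nat -> R) (w_gt0 : forall n, 0 < w n) (wb : bounded_fun w) :
  [set 0] `|` [set lambda : R[i] | Normc.normc lambda < shift_radius w]
    `<=` point_spectrum (backward_shift p1 wb)
  /\ point_spectrum (backward_shift p1 wb)
    `<=` [set lambda : R[i] | Normc.normc lambda <= shift_radius w].
Proof.
have P0 := weight_prod_gt0 w w_gt0.
have rb := bounded_weight_root w w_gt0 wb.
split=> lambda.
- move=> lr; apply/point_spectrum_shiftP => //.
  case: lr => [->|lr].
    (* As 0^0 = 1, the sequence 0^n / P_n is geometric of ratio 0. *)
    apply: (@lp_pred_geometric _ _ _ _ 1 0); rewrite ?ler01 ?lexx ?ltr01//.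
    move=> n; rewrite normc_eigenseq// Normc.normc0 mul1r.
    by case: n => [|n]; rewrite ?weight_prod0 ?divr1// expr0n mul0r.
  have [c lc cr] : exists2 c, Normc.normc lambda < c & c < shift_radius w.
    by eexists; [exact: (midf_lt lr).1|exact: (midf_lt lr).2].
  have c0 : 0 < c by rewrite (le_lt_trans (normc_ge0 lambda)).
  have [|K K0 cK] := @ubound_of_near_le _ (fun n => c ^+ n / weight_prod w n) 1.
    have [N _ cP] := near_le_of_lt_limn_inf _ _ _ rb cr.
    exists N.+1 => // n /= Nn.
    rewrite ler_pdivrMr// mul1r -le_powR_inv ?(ltW c0) ?(ltW (P0 n))//.
      exact/cP/ltnW.
    exact: leq_ltn_trans Nn.
  apply: (@lp_pred_geometric _ _ _ _ K (Normc.normc lambda / c)) => //.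
    by rewrite divr_ge0 ?normc_ge0 ?(ltW c0)//= ltr_pdivrMr// mul1r.
  move=> n; rewrite normc_eigenseq// expr_div_n mulrC mulrA.
  rewrite ler_pdivlMr ?exprn_gt0// mulrAC ler_wpM2r ?exprn_ge0 ?normc_ge0//.
  by rewrite mulrC; exact: cK.
- move=> /point_spectrum_shiftP => /(_ w_gt0) lp /=.
  apply: limn_inf_ge_of_near => //.
  have [N _ xN] := lp_space_near_le _ _ p1 (LpSpace lp) _ ltr01.
  (* The successor makes the index positive, so that n-th roots make sense. *)
  exists N.+1 => // n /= Nn.
  rewrite le_powR_inv ?normc_ge0 ?(ltW (P0 n))//; last exact: leq_ltn_trans Nn.
  have /= := xN n (ltnW Nn).
  by rewrite normc_eigenseq// ler_pdivrMr// mul1r.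
Qed.
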